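(* Let $A$ be a set with at least three elements, let $I$ be a finite set, and let $C\colon \mathrm{PPO}_A^I\to\mathrm{PPO}_A$ be a voting system satisfying unanimity and independence of irrelevant alternatives. Then $C$ also satisfies neutrality and monotonicity. Furthermore, there exist unique subsets $K\subseteq J\subseteq I$ such that: (1) for every profile and all $a,b\in A$, $a\succ_K b$ implies $a\succsim b$, and $K$ is minimal (with respect to inclusion) among subsets of $I$ with this property; moreover each $k\in K$ has veto power: for every profile and all $a,b$, if $(a,b)\notin P_k$ then $(a,b)\notin C(P)$; (2) for every profile and all $a,b\in A$, $a\succsim_J b$ implies $a\succsim b$, and $J$ is minimal among subsets with this property; moreover each $j\in J$ has influence: if $a\succsim_J b$ and $a\succ_j b$, then $a\succ b$. In other words, $K$ is the minimal decisive set and $J$ the minimal strongly decisive set. Every pair $(K,J)$ of subsets with $\emptyset\neq K\subseteq J\subseteq I$ arises in this way from some voting system satisfying unanimity and independence of irrelevant alternatives. The case $K=J=\emptyset$ corresponds to the trivial voting system $C(P)=A\times A$ for all profiles $P$, and the case $K=J$ corresponds to the Pareto rule $C(P_i)_{i\in I}=\bigcap_{j\in J}P_j$.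
   Context: An ordering on a set $A$ is a partial preorder, i.e. a reflexive and transitive relation $P\subseteq A\times A$; $\mathrm{PPO}_A$ denotes the set of all such orderings. A profile is a family $P=(P_i)_{i\in I}\in\mathrm{PPO}_A^I$, and a voting system is a map $C\colon\mathrm{PPO}_A^I\to\mathrm{PPO}_A$. For a profile $P$ write $a\succsim b$ for $(a,b)\in C(P)$ and $a\succsim_i b$ for $(a,b)\in P_i$; $a\succ b$ means $a\succsim b$ and not $b\succsim a$; $a\sim b$ means $a\succsim b$ and $b\succsim a$; analogously with subscript $i$. For $J\subseteq I$, $a\succsim_J b$ means $a\succsim_j b$ for all $j\in J$, and similarly $a\succ_J b$, $a\sim_J b$ (vacuously true if $J=\emptyset$). Unanimity: for every profile and $a,b\in A$, $a\succsim_I b$ implies $a\succsim b$. Independence of irrelevant alternatives (IIA): for profiles $P,P'$ (with outcomes $\succsim,\succsim'$) and $a,b\in A$, if $\{i: a\succsim_i b\}=\{i: a\succsim'_i b\}$ and $\{i: b\succsim_i a\}=\{i: b\succsim'_i a\}$, then $a\succsim b\iff a\succsim' b$. Monotonicity: if $\{i: a\succsim_i b\}\subseteq\{i: a\succsim'_i b\}$ and $\{i: b\succsim_i a\}\supseteq\{i: b\succsim'_i a\}$, then $a\succsim b$ implies $a\succsim' b$. Neutrality: $C(\rho^*P_i)_{i\in I}=\rho^*C(P)$ for every permutation $\rho$ of $A$, where $(a,b)\in\rho^*Q$ iff $(\rho a,\rho b)\in Q$. A subset $J\subseteq I$ is decisive if for every profile and all $a,b$, $a\succ_J b$ implies $a\succsim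 b$; strongly decisive if $a\succsim_J b$ implies $a\succsim b$. *)

(* Defs.v *)
From Corelib Require Import RelationClasses.
From mathcomp Require Import all_boot.
From mathcomp Require Import boolp classical_sets.

Set Implicit Arguments.
Unset Strict Implicit.
Unset Printing Implicit Defensive.

Local Open Scope classical_set_scope.

Record ppo (A : Type) := PPO {
  ppo_set : set (A * A);
  ppo_preorder : PreOrder (fun a b => ppo_set (a, b)) }.

Lemma ppo_eq (A : Type) (Q Q' : ppo A) : ppo_set Q = ppo_set Q' -> Q = Q'.
Proof.
by case: Q Q' => [R p] [R' p'] /= e; subst R'; rewrite (Prop_irrelevance p p').
Qed.

Definition weak (A : Type) (Q : ppo A) (a b : A) : Prop := ppo_set Q (a, b).

Definition strict (A : Type) (Q : ppo A) (a b : A) : Prop :=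
  weak Q a b /\ ~ weak Q b a.

Definition profile (A I : Type) : Type := I -> ppo A.

Definition voting_system (A I : Type) : Type := profile A I -> ppo A.

Definition weak_on (A I : Type) (J : set I) (P : profile A I) (a b : A) : Prop :=
  forall j, J j -> weak (P j) a b.

Definition strict_on (A I : Type) (J : set I) (P : profile A I) (a b : A) : Prop :=
  forall j, J j -> strict (P j) a b.

Definition unanimity (A I : Type) (C : voting_system A I) : Prop :=
  forall (P : profile A I) (a b : A), weak_on setT P a b -> weak (C P) a b.

Definition IIA (A I : Type) (C : voting_system A I) : Prop :=
  forall (P P' : profile A I) (a b : A),
    [set i | weak (P i) a b] = [set i | weak (P' i) a b] ->
    [set i | weak (P i) b a] = [set i | weak (P' i) b a] ->
    (weak (C P) a b <-> weak (C P') a b).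

Definition monotonicity (A I : Type) (C : voting_system A I) : Prop :=
  forall (P P' : profile A I) (a b : A),
    [set i | weak (P i) a b] `<=` [set i | weak (P' i) a b] ->
    [set i | weak (P' i) b a] `<=` [set i | weak (P i) b a] ->
    weak (C P) a b -> weak (C P') a b.

Lemma pullback_preorder (A : Type) (rho : A -> A) (Q : ppo A) :
  PreOrder (fun a b => [set ab | ppo_set Q (rho ab.1, rho ab.2)] (a, b)).
Proof.
have [r t] := ppo_preorder Q.
by split=> [a|a b c]; [exact: r | exact: t].
Qed.

Definition pullback (A : Type) (rho : A -> A) (Q : ppo A) : ppo A :=
  PPO (pullback_preorder rho Q).

Definition neutrality (A I : Type) (C : voting_system A I) : Prop :=
  forall rho : A -> A, bijective rho ->
  forall P : profile A I,
    C (fun i => pullback rho (P i)) = pullback rho (C P).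

Definition decisive (A I : Type) (C : voting_system A I) (J : set I) : Prop :=
  forall (P : profile A I) (a b : A), strict_on J P a b -> weak (C P) a b.

Definition strongly_decisive (A I : Type) (C : voting_system A I) (J : set I) :
    Prop :=
  forall (P : profile A I) (a b : A), weak_on J P a b -> weak (C P) a b.

Definition inclusion_minimal (I : Type) (D : set I -> Prop) (J : set I) : Prop :=
  D J /\ forall J' : set I, J' `<=` J -> D J' -> J' = J.

Definition has_veto (A I : Type) (C : voting_system A I) (k : I) : Prop :=
  forall (P : profile A I) (a b : A), ~ weak (P k) a b -> ~ weak (C P) a b.

(* Influence of j is relative to the strongly decisive set J it belongs to. *)
Definition has_influence (A I : Type) (C : voting_system A I) (J : set I)
    (j : I) : Prop :=
  forall (P : profile A I) (a b : A),
    weak_on J P a b -> strict (P j) a b -> strict (C P) a b.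

Definition power_pair (A I : Type) (C : voting_system A I) (K J : set I) : Prop :=
  [/\ K `<=` J,
      inclusion_minimal (decisive C) K /\ (forall k, K k -> has_veto C k)
    & inclusion_minimal (strongly_decisive C) J /\
      (forall j, J j -> has_influence C J j)].

Definition trivial_system (A I : Type) (C : voting_system A I) : Prop :=
  forall P : profile A I, ppo_set (C P) = [set: A * A].

Definition pareto_rule (A I : Type) (J : set I) (C : voting_system A I) : Prop :=
  forall P : profile A I, ppo_set (C P) = \bigcap_(j in J) ppo_set (P j).

(* Main.v *)
Require Import Defs.
From mathcomp Require Import all_boot.
From mathcomp Require Import boolp classical_sets.

Local Open Scope classical_set_scope.

(** By IIA the outcome [a ≿ b] depends only on the set [S] of voters with
[a ≿_i b] and the set [T] of voters with [b ≿_i a]; call [(S, T)] winning if it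
forces [a ≿ b].  Any six sets of voters which are compatible with transitivity
on three alternatives are realised by a profile, so transitivity of the outcome
lets us compose winning pairs.  Letting all voters be indifferent between two
of the three alternatives gives neutrality, and letting them weakly agree on
one comparison gives monotonicity.  [D] is decisive iff [(D, ~D)] is winning
and strongly decisive iff [(D, I)] is winning; composing shows that both
families are closed under intersections, hence have least elements [K] and [J]
since [I] is finite.  If [k ∈ K] had no veto, or [j ∈ J] no influence, a
further composition would make [I \ {k}] decisive, or [I \ {j}] strongly
decisive. *)

(** * Orders and profiles with prescribed comparisons *)

Lemma weak_refl {A : Type} (Q : ppo A) (a : A) : weak Q a a.
Proof. by have [r _] := ppo_preorder Q; exact: r. Qed.

Lemma weak_trans {A : Type} (Q : ppo A) (b a c : A) :
  weak Q a b -> weak Q b c -> weak Q a c.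
Proof. by have [_ t] := ppo_preorder Q; exact: t. Qed.

Lemma weak_inj {A : Type} (Q Q' : ppo A) :
  (forall a b, weak Q a b <-> weak Q' a b) -> Q = Q'.
Proof.
by move=> e; apply: ppo_eq; apply/seteqP; split=> -[a b] /=; apply e.
Qed.

(** The six implications are exactly transitivity on three distinct points, so the relation with no
    other off-diagonal pairs is a preorder. *)
Lemma three_point_order {A : Type} (a b c : A) (ab ba bc cb ac ca : Prop) :
    a <> b -> b <> c -> a <> c ->
    (ab -> bc -> ac) -> (ba -> ac -> bc) -> (ac -> cb -> ab) ->
    (ca -> ab -> cb) -> (bc -> ca -> ba) -> (cb -> ba -> ca) ->
  exists Q : ppo A, [/\ weak Q a b <-> ab, weak Q b a <-> ba,
                        weak Q b c <-> bc, weak Q c b <-> cb &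
                        (weak Q a c <-> ac) /\ (weak Q c a <-> ca)].
Proof.
move=> nab nbc nac h1 h2 h3 h4 h5 h6.
pose R x y := x = y \/ (x = a /\ y = b /\ ab) \/ (x = b /\ y = a /\ ba) \/
  (x = b /\ y = c /\ bc) \/ (x = c /\ y = b /\ cb) \/
  (x = a /\ y = c /\ ac) \/ (x = c /\ y = a /\ ca).
have Rpre : RelationClasses.PreOrder (fun x y => [set p | R p.1 p.2] (x, y)).
  split=> [x|x y z]; rewrite /= /R; first by left.
  by intuition (subst; try congruence; tauto).
exists (PPO Rpre); rewrite /weak /= /R.
by do 5?split; intuition congruence.
Qed.

Definition supporters {A I : Type} (P : profile A I) (a b : A) : set I :=
  [set i | weak (P i) a b].

Lemma three_point_profile {A I : Type} (a b c : A) (AB BA BC CB AC CA : set I) :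
    a <> b -> b <> c -> a <> c ->
    AB `&` BC `<=` AC -> BA `&` AC `<=` BC -> AC `&` CB `<=` AB ->
    CA `&` AB `<=` CB -> BC `&` CA `<=` BA -> CB `&` BA `<=` CA ->
  exists P : profile A I,
    [/\ supporters P a b = AB, supporters P b a = BA,
        supporters P b c = BC, supporters P c b = CB &
        supporters P a c = AC /\ supporters P c a = CA].
Proof.
move=> nab nbc nac h1 h2 h3 h4 h5 h6.
have /choice[P hP] (i : I) := @three_point_order A a b c
  (AB i) (BA i) (BC i) (CB i) (AC i) (CA i) nab nbc nac
  (fun x y => h1 i (conj x y)) (fun x y => h2 i (conj x y))
  (fun x y => h3 i (conj x y)) (fun x y => h4 i (conj x y))
  (fun x y => h5 i (conj x y)) (fun x y => h6 i (conj x y)).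
exists P; do 5?split; apply/seteqP; split=> i; rewrite /supporters /=;
  by have [????[??]] := hP i; intuition.
Qed.

Lemma exists_third {A : Type} (x y : A) :
  (exists a b c : A, [/\ a <> b, b <> c & a <> c]) ->
  exists z, z <> x /\ z <> y.
Proof.
move=> [a [b [c [nab nbc nac]]]].
have [?|/not_andP ha] := pselect (a <> x /\ a <> y); first by exists a.
have [?|/not_andP hb] := pselect (b <> x /\ b <> y); first by exists b.
exists c; case: ha => /contrapT ea; case: hb => /contrapT eb; subst.
all: split=> e; congruence.
Qed.

Lemma two_point_profile {A I : Type} (a b : A) (S T : set I) :
  (exists a b c : A, [/\ a <> b, b <> c & a <> c]) -> a <> b ->
  exists P : profile A I, supporters P a b = S /\ supporters P b a = T.
Proof.
move=> hA nab; have [c [nca ncb]] := exists_third a b hA.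
(* A third alternative that no voter compares with [a] or [b] makes all six inclusions vacuous. *)
have [|||||||||P [eS eT _ _ _]] :=
  @three_point_profile A I a b c S T set0 set0 set0 set0.
- exact: nab.
- by move/esym.
- by move/esym.
- by move=> i [].
- by move=> i [].
- by move=> i [].
- by move=> i [].
- by move=> i [].
- by move=> i [].
by exists P.
Qed.

(** * Least sets and a criterion for power pairs *)

Lemma setI_closed_least {I : finType} (G : set I -> Prop) :
  G setT -> (forall S T, G S -> G T -> G (S `&` T)) ->
  G [set i | forall S, G S -> S i].
Proof.
move=> GT GI.
(* [f i] is a member of [G] that omits [i] whenever some member does; finitely many such sets cut
   out the least one. *)
have /choice[f hf] (i : I) : exists S, G S /\ (S i -> forall S', G S' -> S' i).
  have [h|/existsNP[S /not_implyP[GS nSi]]] := pselect (forall S, G S -> S i).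
    by exists setT.
  by exists S.
have -> : [set i | forall S, G S -> S i] = \big[setI/setT]_(i : I) f i.
  apply/seteqP; split=> i /=.
    move=> h; elim/big_rec: _ => [//|j S _ Si]; split=> //.
    by apply: h; have [] := hf j.
  by rewrite (bigD1 i) //= => -[fi _]; have [_] := hf i; exact.
by apply: big_ind => [//|//|i _]; have [] := hf i.
Qed.

(** Otherwise let [D] rank [a] strictly above [b] and everybody else [b] strictly above [a]: [D]
    forces what [k] vetoes. *)
Lemma veto_sub_decisive {A I : Type} (C : voting_system A I) (K D : set I) :
  (exists a b c : A, [/\ a <> b, b <> c & a <> c]) ->
  (forall k, K k -> has_veto C k) -> decisive C D -> K `<=` D.
Proof.
move=> hA vK dD k Kk; apply: contrapT => nDk.
have [a [b [_ [nab _ _]]]] := hA.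
have [P [eS eT]] := two_point_profile a b D (~` D) hA nab.
apply: (vK k Kk P a b).
  by change (~ supporters P a b k); rewrite eS.
apply: dD => i Di; split; first by change (supporters P a b i); rewrite eS.
by change (~ supporters P b a i); rewrite eT; apply.
Qed.

(** Otherwise let [D] be indifferent and everybody else strictly prefer [a]: [D] forces [b ≿ a],
    which the influence of [j] forbids. *)
Lemma influence_sub_strongly_decisive {A I : Type} (C : voting_system A I)
    (J D : set I) :
  (exists a b c : A, [/\ a <> b, b <> c & a <> c]) ->
  (forall j, J j -> has_influence C J j) -> strongly_decisive C D -> J `<=` D.
Proof.
move=> hA iJ dD j Jj; apply: contrapT => nDj.
have [a [b [_ [nab _ _]]]] := hA.
have [P [eS eT]] := two_point_profile a b setT D hA nab.
have wP i : weak (P i) a b by change (supporters P a b i); rewrite eS.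
have [||_] := iJ j Jj P a b; first by move=> i _.
  by split=> //; change (~ supporters P b a j); rewrite eT.
by apply; apply: dD => i Di; change (supporters P b a i); rewrite eT.
Qed.

(** Minimality comes for free: veto and influence put [K] and [J] inside every competitor. *)
Lemma power_pairI {A I : Type} (C : voting_system A I) (K J : set I) :
  (exists a b c : A, [/\ a <> b, b <> c & a <> c]) ->
  K `<=` J -> decisive C K -> (forall k, K k -> has_veto C k) ->
  strongly_decisive C J -> (forall j, J j -> has_influence C J j) ->
  power_pair C K J.
Proof.
move=> hA KJ dK vK dJ iJ; split=> //; split=> //; split=> // D sD dD;
  apply/seteqP; split=> //.
- exact: veto_sub_decisive dD.
- exact: influence_sub_strongly_decisive dD.
Qed.

(** * Calculus of winning pairs *)

Section Winning.
Context {A : Type} {I : finType} {C : voting_system A I}.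
Hypothesis hA : exists a b c : A, [/\ a <> b, b <> c & a <> c].
Hypothesis una : unanimity C.
Hypothesis iia : IIA C.

Definition wins (a b : A) (S T : set I) : Prop :=
  forall P, supporters P a b = S -> supporters P b a = T -> weak (C P) a b.

Lemma weak_wins P a b :
  weak (C P) a b <-> wins a b (supporters P a b) (supporters P b a).
Proof.
split=> [w P' eS eT|]; last exact.
by apply/(iia P' P).
Qed.

Lemma unanimity_wins a b T : wins a b setT T.
Proof.
move=> P eS _; apply: una => i _.
by change (supporters P a b i); rewrite eS.
Qed.

Lemma wins_trans {a b c} {AB BA BC CB AC CA : set I} :
    a <> b -> b <> c -> a <> c -> wins a b AB BA -> wins b c BC CB ->
    AB `&` BC `<=` AC -> BA `&` AC `<=` BC -> AC `&` CB `<=` AB ->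
    CA `&` AB `<=` CB -> BC `&` CA `<=` BA -> CB `&` BA `<=` CA ->
  wins a c AC CA.
Proof.
move=> nab nbc nac wab wbc h1 h2 h3 h4 h5 h6.
have [P [eab eba ebc ecb [<- <-]]] := three_point_profile a b c
  AB BA BC CB AC CA nab nbc nac h1 h2 h3 h4 h5 h6.
by apply/weak_wins; apply: (weak_trans _ b); [exact: wab | exact: wbc].
Qed.

Lemma wins_replace_right a b c S T :
  a <> b -> a <> c -> wins a b S T -> wins a c S T.
Proof.
move=> nab nac w; have [<-//|nbc] := pselect (b = c).
(* Every voter is made indifferent between [b] and [c]. *)
by apply: (wins_trans nab nbc nac w (unanimity_wins b c setT)) => i /= [].
Qed.

Lemma wins_replace_left a b c S T :
  a <> b -> c <> b -> wins a b S T -> wins c b S T.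
Proof.
move=> nab ncb w; have [->//|nca] := pselect (c = a).
by apply: (wins_trans nca nab ncb (unanimity_wins c a setT) w) => i /= [].
Qed.

Lemma wins_neutral a b c d S T :
  a <> b -> c <> d -> wins a b S T -> wins c d S T.
Proof.
move=> nab ncd w; have [ecb|ncb] := pselect (c = b); last first.
  apply: (wins_replace_right c b) => //; exact: (wins_replace_left a b).
(* When [c = b], the replacements detour through a third alternative: [(a, b)], [(a, e)], [(b, e)],
   [(b, d)]. *)
subst c; have [e [nea neb]] := exists_third a b hA.
have nae : a <> e by move/esym.
have nbe : b <> e by move/esym.
apply: (wins_replace_right b e) => //; apply: (wins_replace_left a e) => //.
exact: (wins_replace_right a b).
Qed.

Definition winning (S T : set I) : Prop := forall a b, a <> b -> wins a b S T.

Lemma weak_winning P a b : a <> b ->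
  weak (C P) a b <-> winning (supporters P a b) (supporters P b a).
Proof.
move=> nab; split=> [/weak_wins w c d ncd|w]; last by apply: w.
exact: wins_neutral nab ncd w.
Qed.

Lemma winning_weak P a b :
  winning (supporters P a b) (supporters P b a) -> weak (C P) a b.
Proof.
have [e|nab] := pselect (a = b); first by subst; move=> _; exact: weak_refl.
by apply weak_winning.
Qed.

Lemma winning_trans (AB BA BC CB : set I) {AC CA : set I} :
    winning AB BA -> winning BC CB ->
    AB `&` BC `<=` AC -> BA `&` AC `<=` BC -> AC `&` CB `<=` AB ->
    CA `&` AB `<=` CB -> BC `&` CA `<=` BA -> CB `&` BA `<=` CA ->
  winning AC CA.
Proof.
move=> wab wbc h1 h2 h3 h4 h5 h6 a c nac.
have [b [nba nbc]] := exists_third a c hA.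
have nab : a <> b by move/esym.
exact: (wins_trans nab nbc nac (wab _ _ nab) (wbc _ _ nbc)).
Qed.

Lemma unanimity_winning T : winning setT T.
Proof. by move=> a b _; exact: unanimity_wins. Qed.

Lemma winning_mono (S T S' T' : set I) :
  S `<=` S' -> T' `<=` T -> winning S T -> winning S' T'.
Proof.
move=> sS sT w.
(* Everybody weakly prefers the middle alternative to the last; [T' ∩ S] is the smallest set of
   converse supporters that transitivity allows. *)
apply: (winning_trans S T setT (T' `&` S) w (unanimity_winning _)) => i /=;
  by move: (sS i) (sT i); tauto.
Qed.

Lemma unanimity_IIA_monotonicity : monotonicity C.
Proof.
move=> P P' a b sS sT w.
have [e|nab] := pselect (a = b); first by subst; exact: weak_refl.
apply: winning_weak; apply: (winning_mono _ _ _ _ sS sT).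
by apply/weak_winning.
Qed.

Lemma unanimity_IIA_neutrality : neutrality C.
Proof.
move=> rho /bij_inj rhoI P; apply: weak_inj => a b.
have [<-|nab] := pselect (a = b); first by split=> _; exact: weak_refl.
have nrab : rho a <> rho b by move/rhoI.
rewrite (weak_winning _ _ _ nab).
(* The supporters in the pulled-back profile at [a], [b] are, by computation, those in [P] at
   [rho a], [rho b]. *)
exact: iff_sym (weak_winning P _ _ nrab).
Qed.

(** * Decisive sets and their least elements *)

Lemma decisiveP D : decisive C D <-> winning D (~` D).
Proof.
split=> [dD a b nab P eS eT|w P a b sab].
  apply: dD => i Di; split; first by change (supporters P a b i); rewrite eS.
  by change (~ supporters P b a i); rewrite eT; apply.
(* By monotonicity, [(D, ~D)] is the worst case compatible with strict preference on [D]. *)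
apply: winning_weak; apply: winning_mono w => i; first by case/sab.
by move=> wba /sab[].
Qed.

Lemma strongly_decisiveP D : strongly_decisive C D <-> winning D setT.
Proof.
split=> [dD a b nab P eS eT|w P a b sab].
  by apply: dD => i Di; change (supporters P a b i); rewrite eS.
by apply: winning_weak; apply: winning_mono w.
Qed.

(** As in Condorcet's paradox, [D] ranks a above b and [D'] ranks b above c, while all voters
    outside [D ∩ D'] rank c above a. *)
Lemma decisiveI D D' : decisive C D -> decisive C D' -> decisive C (D `&` D').
Proof.
move=> /decisiveP w /decisiveP w'; apply/decisiveP.
by apply: (winning_trans _ _ _ _ w w') => i /=;
  have [Di|Di] := pselect (D i); have [Di'|Di'] := pselect (D' i); tauto.
Qed.

Lemma strongly_decisiveI D D' : strongly_decisive C D ->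
  strongly_decisive C D' -> strongly_decisive C (D `&` D').
Proof.
move=> /strongly_decisiveP w /strongly_decisiveP w'; apply/strongly_decisiveP.
by apply: (winning_trans _ _ _ _ w w') => i /=; tauto.
Qed.

Lemma unanimity_decisive : decisive C setT.
Proof. by apply/decisiveP; exact: unanimity_winning. Qed.

Lemma unanimity_strongly_decisive : strongly_decisive C setT.
Proof. by apply/strongly_decisiveP; exact: unanimity_winning. Qed.

Lemma strongly_decisive_decisive D : strongly_decisive C D -> decisive C D.
Proof. by move=> dD P a b sab; apply: dD => i /sab[]. Qed.

Definition decisive_core : set I := [set i | forall D, decisive C D -> D i].

Definition strongly_decisive_core : set I :=
  [set i | forall D, strongly_decisive C D -> D i].

Lemma decisive_core_decisive : decisive C decisive_core.
Proof.
exact: (setI_closed_least (decisive C) unanimity_decisive decisiveI).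
Qed.

Lemma strongly_decisive_core_strongly_decisive :
  strongly_decisive C strongly_decisive_core.
Proof.
exact: (setI_closed_least (strongly_decisive C) unanimity_strongly_decisive
  strongly_decisiveI).
Qed.

(* The pair [(I \ {k}, ∅)] is winning; use it for [a ≿ b] and for [b ≿ c] in a
   profile where [k] ranks [c] above [a] and leaves [b] incomparable to both,
   while everybody else ranks [a] above [b] above [c]. *)
Lemma decisive_core_veto k : decisive_core k -> has_veto C k.
Proof.
move=> Kk P a b nPk wab.
have nab : a <> b by move=> e; subst; apply: nPk; exact: weak_refl.
have w : winning (~` [set k]) set0.
  move/(weak_winning _ _ _ nab): wab; apply: winning_mono => // i Pi ik.
  by apply: nPk; move: Pi; rewrite /supporters /= ik.
have : decisive C (~` [set k]).
  by apply/decisiveP; apply: (winning_trans _ _ _ _ w w) => i /=; tauto.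
by move/Kk; apply.
Qed.

(* If [b ≿ a] held, then [x ≿ y] would follow from [(I \ {j}, S)], where
   [S ⊇ J] is the set of voters with [a ≿_i b], and [y ≿ z] from [J]; the profile
   has [x ~ z ≻ y] outside [S], [y ~ z ≻ x] for [j] and [x ~ y ~ z] elsewhere. *)
Lemma strongly_decisive_core_influence j : strongly_decisive_core j ->
  has_influence C strongly_decisive_core j.
Proof.
move=> Jj P a b wJ [wjab nwjba].
have wab := strongly_decisive_core_strongly_decisive _ _ _ wJ.
split=> // wba.
have nba : b <> a by move=> e; subst; apply: nwjba; exact: weak_refl.
set S := supporters P a b.
have Sj : S j by [].
have w1 : winning (~` [set j]) S.
  move/(weak_winning _ _ _ nba): wba; apply: winning_mono => // i Pi ij.
  by apply: nwjba; move: Pi; rewrite /supporters /= ij.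
have w2 : winning S setT.
  apply: (winning_mono _ _ _ _ wJ); first exact: subset_refl.
  exact/strongly_decisiveP/strongly_decisive_core_strongly_decisive.
have : strongly_decisive C (~` [set j]).
  apply/strongly_decisiveP; apply: (winning_trans _ _ _ _ w1 w2) => i /=;
    have [->|nij] := pselect (i = j); tauto.
by move/Jj; apply.
Qed.

Lemma power_pair_cores : power_pair C decisive_core strongly_decisive_core.
Proof.
apply: power_pairI.
- exact: hA.
- move=> k; apply; apply: strongly_decisive_decisive.
  exact: strongly_decisive_core_strongly_decisive.
- exact: decisive_core_decisive.
- exact: decisive_core_veto.
- exact: strongly_decisive_core_strongly_decisive.
- exact: strongly_decisive_core_influence.
Qed.

(** Each core competes and lies inside every competitor, so minimality forces equality. *)
Lemma inclusion_minimal_cores K J :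
  inclusion_minimal (decisive C) K -> inclusion_minimal (strongly_decisive C) J ->
  K = decisive_core /\ J = strongly_decisive_core.
Proof.
move=> [dK mK] [dJ mJ]; split; apply/esym.
  by apply: mK decisive_core_decisive => k; exact.
by apply: mJ strongly_decisive_core_strongly_decisive => j; exact.
Qed.

End Winning.

(** * A system realising a given pair *)

Section Lexicographic.
Context {A I : Type} (K J : set I).

Definition lex_weak (P : profile A I) (a b : A) : Prop :=
  (weak_on K P a b /\ ~ weak_on K P b a) \/
  (weak_on K P a b /\ weak_on J P a b).

Lemma weak_on_trans (L : set I) (P : profile A I) b a c :
  weak_on L P a b -> weak_on L P b c -> weak_on L P a c.
Proof.
by move=> wab wbc i Li; apply: (weak_trans _ b); [exact: wab | exact: wbc].
Qed.

Lemma lex_preorder P : RelationClasses.PreOrder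
  (fun a b => [set ab | lex_weak P ab.1 ab.2] (a, b)).
Proof.
split=> [a|a b c] /=.
  by right; split=> i _; exact: weak_refl.
have t1 := weak_on_trans K P; have t2 := weak_on_trans J P.
(* If [K] is strict in either step, [weak_on K P c a] would chain back to reverse that step. *)
move=> [] [wab h] [] [wbc h'].
- left; split; first exact: t1 wbc.
  by move=> wca; apply: h; exact: t1 wca.
- left; split; first exact: t1 wbc.
  by move=> wca; apply: h; exact: t1 wca.
- left; split; first exact: t1 wbc.
  by move=> wca; apply: h'; exact: t1 wab.
- by right; split; [exact: t1 wbc | exact: t2 h'].
Qed.

(* The committee [K] votes by the Pareto rule, and [J] refines its ties. *)
Definition lex_system : voting_system A I := fun P => PPO (lex_preorder P).

Lemma lex_unanimity : unanimity lex_system.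
Proof. by move=> P a b w; right; split=> i _; exact: w. Qed.

Lemma lex_IIA : IIA lex_system.
Proof.
move=> P P' a b /seteqP[e1 e2] /seteqP[e3 e4].
have eL (L : set I) : (weak_on L P a b <-> weak_on L P' a b) /\
                      (weak_on L P b a <-> weak_on L P' b a).
  by split; split=> w i Li; have := w i Li; [exact: e1|exact: e2|exact: e3|
    exact: e4].
by have [] := eL K; have [] := eL J; rewrite /weak /= /lex_weak; tauto.
Qed.

Lemma lex_power_pair :
  (exists a b c : A, [/\ a <> b, b <> c & a <> c]) ->
  K <> set0 -> K `<=` J -> power_pair lex_system K J.
Proof.
move=> hA /eqP/set0P[k0 Kk0] KJ; apply: power_pairI => //.
- move=> P a b s; left; split=> [i Ki|w]; first by have [] := s i Ki.
  (* The member [k0] turns strictness voter by voter into the failure of [weak_on K P b a], which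
     would hold vacuously for empty [K]. *)
  by have [_] := s k0 Kk0; apply; exact: w.
- by move=> k Kk P a b nw [] [wK _]; apply: nw; exact: wK.
- by move=> P a b w; right; split=> // i /KJ; exact: w.
- move=> j Jj P a b w [_ njba].
  have wK : weak_on K P a b by move=> i /KJ; exact: w.
  split; first by right.
  by case=> [[_ /(_ wK)//]|[_ /(_ j Jj)]].
Qed.

End Lexicographic.

(** * Pareto rules and the trivial system *)

Lemma pareto_ruleP {A I : Type} (J : set I) (C : voting_system A I) :
  pareto_rule J C <-> forall P a b, weak (C P) a b <-> weak_on J P a b.
Proof.
split=> [e P a b|e P]; first by rewrite /weak e.
by apply/seteqP; split=> -[a b] /=; apply e.
Qed.

Lemma pareto_unanimity_IIA {A I : Type} (J : set I) (C : voting_system A I) :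
  pareto_rule J C -> unanimity C /\ IIA C.
Proof.
move=> /pareto_ruleP e; split=> [P a b w|P P' a b /seteqP[e1 e2] _].
  by apply/e => i _; exact: w.
by split=> /e w; apply/e => i Ji; [apply: e1 | apply: e2]; exact: w.
Qed.

(** From left to right, strong decisiveness of [J] puts the intersection inside the outcome, and the
    vetoes give the converse inclusion. *)
Lemma power_pair_pareto {A I : Type} (J : set I) (C : voting_system A I) :
  (exists a b c : A, [/\ a <> b, b <> c & a <> c]) ->
  power_pair C J J <-> pareto_rule J C.
Proof.
move=> hA; split=> [[_ [_ vJ] [[dJ _] _]]|/pareto_ruleP e].
  apply/pareto_ruleP => P a b; split=> [w j Jj|]; last exact: dJ.
  by apply: contrapT => nw; exact: (vJ j Jj P a b nw).
apply: power_pairI => //.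
- by move=> P a b s; apply/e => i /s[].
- by move=> k Jk P a b nw /e w; apply: nw; exact: w.
- by move=> P a b w; apply/e.
- by move=> j Jj P a b w [_ nba]; split; [apply/e | move/e/(_ j Jj)].
Qed.

Lemma trivial_pareto {A I : Type} (C : voting_system A I) :
  trivial_system C <-> pareto_rule set0 C.
Proof.
by split=> h P; rewrite h bigcap_set0.
Qed.

Theorem theorem1p1 (A : Type) (I : finType)
    (hA : exists a b c : A, [/\ a <> b, b <> c & a <> c]) :
  (forall C : voting_system A I, unanimity C -> IIA C ->
     [/\ neutrality C,
         monotonicity C,
         exists! KJ : set I * set I, power_pair C KJ.1 KJ.2
       & forall K J : set I,
           power_pair C K J <->
           inclusion_minimal (decisive C) K /\
           inclusion_minimal (strongly_decisive C) J]) /\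
  (forall K J : set I, K <> set0 -> K `<=` J ->
     exists C : voting_system A I,
       [/\ unanimity C, IIA C & power_pair C K J]) /\
  (forall C : voting_system A I,
     [/\ unanimity C, IIA C & power_pair C set0 set0] <-> trivial_system C) /\
  (forall (C : voting_system A I) (J : set I),
     [/\ unanimity C, IIA C & power_pair C J J] <-> pareto_rule J C).
Proof.
have pareto (C : voting_system A I) (J : set I) :
    [/\ unanimity C, IIA C & power_pair C J J] <-> pareto_rule J C.
  split=> [[_ _] /(power_pair_pareto _ _ hA)//|p].
  by have [] := pareto_unanimity_IIA _ _ p; split=> //; apply/power_pair_pareto.
split; last split; last split=> //.
- move=> C una iia; have pp := power_pair_cores hA una iia; split.
  + exact: unanimity_IIA_neutrality.
  + exact: unanimity_IIA_monotonicity.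
  (* The two minimality conditions alone determine the pair; the next clause rests on the same
     fact. *)
  + exists (decisive_core (C := C), strongly_decisive_core (C := C)).
    split=> // -[K J] /= [_ [mK _] [mJ _]].
    by have [-> ->] := inclusion_minimal_cores hA una iia _ _ mK mJ.
  + move=> K J; split=> [[_ [mK _] [mJ _]]//|[mK mJ]].
    by have [-> ->] := inclusion_minimal_cores hA una iia _ _ mK mJ.
- move=> K J K0 KJ; exists (lex_system K J); split.
  + exact: lex_unanimity.
  + exact: lex_IIA.
  + exact: lex_power_pair.
- by move=> C; apply: iff_trans (pareto C set0) (iff_sym (trivial_pareto C)).
Qed.
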